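(* Let $n\ge 3$ and $r\ge 0$ be integers, put $m=r+1$, and let $p$ be a prime with $p>n$ and $m\mid p-1$. Let $\mathcal M_1=\{M\in\mathcal M:\mu_1(M)\ge 2\}$ be the set of size-$n$ multisets from $\Omega$ in which the element $1$ has multiplicity at least $2$. Then $$H_n(r)=m^{1-n}\sum_{M\in\mathcal M_1}\frac{\operatorname{mult}(M)}{t(M)}\,\Theta(M)\quad\text{in }\mathbb F_p .$$ The formula is valid even when some orbits of the scaling action of $\Omega$ on $\mathcal M$ have nontrivial stabilizers.
   Context: $H_n(r)$ is the number of $n\times n$ matrices with nonnegative integer entries all of whose row sums and column sums equal $r$; in an identity in $\mathbb F_p$ integers are reduced modulo $p$. $\Omega=\{a\in\mathbb F_p:a^m=1\}$, which has exactly $m$ elements. $\mathcal M$ is the set of multisets of size $n$ with elements in $\Omega$. For $M\in\mathcal M$, $\mu_a=\mu_a(M)$ is the multiplicity of $a$ in $M$. $h_r(x_1,\dots,x_n)=\sum_{\alpha_1+\cdots+\alpha_n=r,\ \alpha_i\ge0}x_1^{\alpha_1}\cdots x_n^{\alpha_n}$ is the complete homogeneous symmetric polynomial, and $h_r(M)$ is its value on the entries of $M$ (with multiplicity). Further $$\operatorname{mult}(M)=\frac{n!}{\prod_a\mu_a!},\qquad \Theta(M)=\Big(\prod_a a^{\mu_a}\Big)h_r(M)^n,\qquad t(M)=\#\{a:\mu_a\ge 2\}.$$ The scaling action is $\lambda\cdot M=\lambda M$ (multiply every entry by $\lambda\in\Omega$). *)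

(* Defs.v *)
From HB Require Import structures.
From mathcomp Require Import all_boot all_order all_algebra finmap multiset.

Set Implicit Arguments.
Unset Strict Implicit.
Unset Printing Implicit Defensive.

Import GRing.Theory.
Local Open Scope mset_scope.
Local Open Scope ring_scope.

(* Entries are taken in 'I_r.+1 so that the matrices form a finite type; by
   [line_sum_bound] this loses none of the nonnegative integer matrices whose
   row sums are r. *)
Definition H (n r : nat) : nat :=
  #|[set A : 'M['I_r.+1]_n |
       [forall i, (\sum_(j < n) A i j == r)%N] &&
       [forall j, (\sum_(i < n) A i j == r)%N]]|.

Lemma line_sum_bound (n r : nat) (A : 'M[nat]_n) :
  (forall i, \sum_(j < n) A i j = r)%N -> forall i j, (A i j < r.+1)%N.
Proof. by move=> rowA i j; rewrite ltnS -(rowA i) (bigD1 j) //= leq_addr. Qed.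

Definition hsym (R : comNzRingType) (r n : nat) (x : 'I_n -> R) : R :=
  \sum_(alpha : {ffun 'I_n -> 'I_r.+1} | (\sum_i alpha i == r)%N)
     \prod_i x i ^+ alpha i.

Section Multisets.

Variable F : finFieldType.
Implicit Type M : {mset F}.

Definition Omega (m : nat) : {set F} := [set a | a ^+ m == 1].

(* [{mset F}] is infinite; the multisets of size n with elements in A are
   obtained as those of the n-tuples over A, see [in_multisets]. *)
Definition multisets (n : nat) (A : {set F}) : {fset {mset F}} :=
  [fset seq_mset (val t) | t in [set t : n.-tuple F | all (mem A) t]]%fset.

Lemma in_multisets (n : nat) (A : {set F}) M :
  (M \in multisets n A) = (size M == n) && all (mem A) M.
Proof.
apply/imfsetP/andP => [[t /=]|[/eqP sM AM]].
  rewrite inE => At ->; have e := perm_eq_seq_mset (val t).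
  by rewrite (perm_all _ e) (perm_size e) size_tuple eqxx.
have sM' : size M == n by apply/eqP.
by exists (Tuple sM'); rewrite /= ?inE ?seq_mset_id.
Qed.

Definition hM (r : nat) M : F := hsym r (fun i : 'I_(size M) => M`_i).

(* The quotient of natural numbers is exact, being a multinomial coefficient. *)
Definition mult M : nat := ((size M)`! %/ \prod_(a : F) (M a)`!)%N.

Definition Theta (r : nat) M : F :=
  (\prod_(a : F) a ^+ M a) * hM r M ^+ size M.

Definition tM M : nat := #|[set a | (2 <= M a)%N]|.

Definition multisets1 (n m : nat) : {fset {mset F}} :=
  [fset M in multisets n (Omega m) | (2 <= M 1%R)%N]%fset.

End Multisets.

Arguments Omega : clear implicits.
Arguments multisets1 : clear implicits.

(* Main.v *)
(* Write m = r + 1.  H_n(r) is the coefficient of (x_1...x_n)^r in h_r(x)^n, a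
   form of degree nr.  Summing x_1...x_n h_r(x)^n over x in Omega^n multiplies
   by m^n the coefficients of the monomials whose exponents are all congruent
   to r modulo m and kills the others; such exponents are at least r, hence by
   degree equal to r.  So m^n H_n(r) is the sum over Omega^n.
   When the entries of x are distinct, prod_i (1 - x_i X) divides 1 - X^m with a
   quotient of degree m - n < r, which forces h_r(x) = 0; so every contributing
   x has a repeated entry.  Share the term of x equally among its t(x) repeated
   values a, and rescale by 1/a: each a in Omega contributes the same sum over
   the x in which 1 is repeated, whatever the stabilizers are. *)
Require Import Defs.
From mathcomp Require Import all_boot all_order all_algebra finmap multiset.
From mathcomp Require Import cyclic finfield.
From mathcomp Require Import zify ring.
Set Implicit Arguments.
Unset Strict Implicit.
Unset Printing Implicit Defensive.
Import GRing.Theory.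
Local Open Scope mset_scope.
Local Open Scope ring_scope.

(** * Counting the orderings of a multiset *)

(** Induction on length, sorting the permutations by first letter [x]: the rest permutes [rem x s],
    and putting [x] back multiplies the product of factorials by the multiplicity of [x]. These
    multiplicities add up to the size. *)
Lemma size_permutations_mul (T : finType) (s : seq T) :
  (size (permutations s) * \prod_(a : T) (count_mem a s)`! = (size s)`!)%N.
Proof.
have [k sk] := ubnP (size s); elim: k s sk => // k IH s /ltnSE sk.
have [->|/eqP s0] := s =P [::]; first by rewrite big1.
have sz : (0 < size s)%N by rewrite lt0n size_eq0.
rewrite (perm_size (permutationsE sz)) size_allpairs_dep.
rewrite sumnE big_map big_uniq ?undup_uniq //= big_distrl /=.
transitivity (\sum_(x in s) count_mem x s * (size s).-1`!)%N.
  apply: eq_big => [x|x]; first by rewrite mem_undup.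
  rewrite mem_undup => xs.
  rewrite -(size_rem xs) -IH ?size_rem ?(leq_trans _ sk) ?prednK //.
  rewrite mulnCA; congr (_ * _)%N.
  rewrite (bigD1 x) //= [in RHS](bigD1 x) //= count_mem_rem eqxx subn1 mulnA.
  have : (0 < count_mem x s)%N by rewrite -has_count has_pred1.
  case: (count_mem x s) => // c _; rewrite -factS; congr (_ * _)%N.
  by apply: eq_bigr => a ax; rewrite count_mem_rem eq_sym (negPf ax) subn0.
rewrite -big_distrl /=.
have -> : (\sum_(x in s) count_mem x s)%N = size s.
  rewrite -sum1_size (eq_bigr (fun x => \sum_(i <- s | i == x) 1)%N); last first.
    by move=> x _; rewrite sum1_count.
  rewrite (exchange_big_dep (mem s)) //=; last by move=> x y xs /eqP ->.
  rewrite -big_seq; apply: eq_big_seq => y ys.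
  rewrite (big_pred1 y) // => x.
  by rewrite /= (eq_sym x); case: eqP => [<-|]; rewrite ?andbF // ys.
by case: (size s) sz.
Qed.

Lemma card_perm_eq_tuple (T : finType) (n : nat) (s : seq T) : size s = n ->
  #|[set t : n.-tuple T | perm_eq t s]| =
    (n`! %/ \prod_(a : T) (count_mem a s)`!)%N.
Proof.
move=> sn; rewrite -sn -size_permutations_mul mulnK; last first.
  by apply: prodn_gt0 => a; apply: fact_gt0.
rewrite cardE -(size_map val) sn.
apply/perm_size/uniq_perm;
  rewrite ?map_inj_uniq ?enum_uniq ?permutations_uniq //.
  exact: val_inj.
move=> u; rewrite mem_permutations; apply/mapP/idP => [[t]|us].
  by rewrite mem_enum inE => ts ->.
have su : size u == n by rewrite (perm_size us) sn.
by exists (Tuple su); rewrite // mem_enum inE.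
Qed.

(** * Complete homogeneous symmetric polynomials *)

(** Geometric series truncated at degree [r] suffice, since no exponent in a monomial of degree [r]
    exceeds [r]. *)
Lemma hsym_coef (R : comNzRingType) (r n : nat) (x : 'I_n -> R) :
  hsym r x = (\prod_i \poly_(k < r.+1) x i ^+ k)`_r.
Proof.
under eq_bigr do rewrite poly_def.
rewrite bigA_distr_bigA /= coef_sum /hsym big_mkcond /=.
apply: eq_bigr => f _.
rewrite (eq_bigr (fun i => (x i ^+ f i)%:P * 'X^(f i))); last first.
  by move=> i _; rewrite mul_polyC.
rewrite big_split /= -rmorph_prod /= coefCM -expr_sum coefXn eq_sym.
by case: eqP => _; rewrite ?mulr1 ?mulr0.
Qed.

Lemma hsym_scale (R : comNzRingType) (r n : nat) (a : R) (x : 'I_n -> R) :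
  hsym r (fun i => a * x i) = a ^+ r * hsym r x.
Proof.
rewrite /hsym big_distrr /=; apply: eq_bigr => f /eqP fr.
have -> : a ^+ r = \prod_i a ^+ f i by rewrite -expr_sum fr.
rewrite -big_split /=; apply: eq_bigr => i _.
by rewrite exprMn.
Qed.

(** [seq_mset t] may list the entries in another order; the product form of [hsym_coef] does not see
    the order. *)
Lemma hM_seq_mset (F : finFieldType) (r : nat) (n : nat) (t : n.-tuple F) :
  hM r (seq_mset t) = hsym r (tnth t).
Proof.
rewrite /hM !hsym_coef; congr (_`_r).
rewrite -(big_tuple _ _ _ xpredT (fun a => \poly_(k < r.+1) a ^+ k)).
rewrite -(perm_big _ (perm_eq_seq_mset t)) /= (big_nth 0) big_mkord.
by [].
Qed.

Lemma hsym_uniq (F : fieldType) (r n : nat) (t : n.-tuple F) :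
  (2 <= n)%N -> uniq t -> {in t, forall a, a ^+ r.+1 = 1} ->
  hsym r (tnth t) = 0.
Proof.
move=> n2 Ut t1; rewrite hsym_coef.
rewrite -(big_tuple _ _ _ xpredT (fun a => \poly_(k < r.+1) a ^+ k)) /=.
set G := \prod_(a <- t) _.
pose E : {poly F} := \prod_(a <- t) (1 - a *: 'X).
have t0 a : a \in t -> a != 0.
  move=> /t1 a1; apply/eqP => a0; move: a1; rewrite a0 expr0n /= => /esym/eqP.
  by rewrite oner_eq0.
have EG : E * G = (1 - 'X^(r.+1)) ^+ n.
  rewrite /E /G -big_split /=.
  rewrite (eq_big_seq (fun=> 1 - 'X^(r.+1))); last first.
    move=> a /t1 a1; rewrite poly_def.
    rewrite (eq_bigr (fun i : 'I_r.+1 => (a *: 'X) ^+ i)); last first.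
      by move=> i _; rewrite exprZn.
    by rewrite -opprB mulNr -subrX1 exprZn a1 scale1r opprB.
  by rewrite big_const_seq count_predT size_tuple iter_mulr_1.
(* The roots of [E] are the inverses of the entries, hence distinct roots of ['X^(r.+1) - 1]. *)
have E1 : E = \prod_(a <- t) (- a) *: \prod_(b <- map GRing.inv t) ('X - b%:P).
  rewrite big_map -scaler_prod; apply: eq_big_seq => a /t0 a0.
  by rewrite scaleNr scalerBr opprB -[a *: _%:P]mul_polyC -polyCM mulfV.
have c0 : \prod_(a <- t) (- a) != 0.
  by rewrite prodf_seq_neq0; apply/allP => a /t0; rewrite /= oppr_eq0.
have [Q XQ] : exists Q,
    'X^(r.+1) - 1 = Q * \prod_(b <- map GRing.inv t) ('X - b%:P).
  apply: uniq_roots_prod_XsubC; last first.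
    by rewrite uniq_rootsE map_inj_uniq //; apply: invr_inj.
  apply/allP => _ /mapP[a /t1 a1 ->].
  by rewrite rootE !hornerE exprVn a1 invr1 subrr.
set P := \prod_(b <- map _ _) _ in E1 XQ.
have P0 : P != 0 by apply/monic_neq0/monic_prod_XsubC.
have Q0 : Q != 0.
  apply/eqP => Q0; move: XQ; rewrite Q0 mul0r => /eqP.
  by rewrite -size_poly_eq0 size_XnsubC.
(* The size of [Q] is exactly [r + 2 - n]; this is where [2 <= n] enters. *)
have sQ : (size Q <= r)%N.
  have := congr1 (fun p : {poly F} => size p) XQ.
  rewrite size_XnsubC // size_mul //.
  by rewrite size_prod_XsubC size_map size_tuple; move: (size Q) => q; lia.
(* Modulo ['X^(r.+1)] this power is 1, so up to a nonzero scalar [G] agrees with [Q] through degree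
   [r]. *)
have [R ER] : exists R, (1 - 'X^(r.+1)) ^+ n.-1 = 1 + 'X^(r.+1) * R :> {poly F}.
  elim: n.-1 => [|k [R ER]]; first by exists 0; rewrite mulr0 addr0.
  exists (R - 1 - 'X^(r.+1) * R); rewrite exprS ER; ring.
have cG : \prod_(a <- t) (- a) *: G = - (Q + 'X^(r.+1) * (R * Q)).
  apply: (mulfI P0); rewrite -scalerAr scalerAl -E1 EG.
  rewrite -[n in LHS](ltn_predK n2) exprS ER -opprB XQ; ring.
apply: (mulfI c0); rewrite mulr0 -coefZ cG coefN coefD coefXnM ltnSn addr0.
by rewrite nth_default // oppr0.
Qed.

(** * Extracting the matrix count by power sums over the roots of unity *)

Lemma sum_Omega_expr (F : finFieldType) (m k : nat) (z : F) :
    m.-primitive_root z ->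
  \sum_(a in Omega F m) a ^+ k = if (m %| k)%N then m%:R else 0.
Proof.
move=> pz; have -> : \sum_(a in Omega F m) a ^+ k = \sum_(i < m) (z ^+ k) ^+ i.
  have inj : {in xpredT &, injective (fun i : 'I_m => z ^+ i)}.
    move=> i j _ _ /eqP; rewrite (eq_prim_root_expr pz) !modn_small // => /eqP.
    exact: val_inj.
  have -> : Omega F m = [set z ^+ i | i : 'I_m].
    apply/setP => a; rewrite inE; apply/eqP/imsetP.
      by case/(prim_rootP pz) => i ->; exists i.
    by case=> i _ ->; rewrite exprAC (prim_expr_order pz) expr1n.
  rewrite (big_imset _ inj).
  by apply: eq_bigr => i _; rewrite exprAC.
rewrite (prim_order_dvd pz); case: eqP => [->|/eqP zk].
  rewrite (eq_bigr (fun=> 1)) ?sumr_const ?card_ord // => i _.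
  by rewrite expr1n.
have := subrX1 (z ^+ k) m; rewrite exprAC (prim_expr_order pz) expr1n subrr.
by move/esym/eqP; rewrite mulf_eq0 subr_eq0 (negPf zk) => /eqP.
Qed.

(** Matrices as families of rows: the index set produced by expanding the [n]-th power of [hsym]. *)
Lemma H_ffun (n r : nat) :
  H n r = #|[set f : {ffun 'I_n -> {ffun 'I_n -> 'I_r.+1}} |
    [forall i, (\sum_j f i j == r)%N] && [forall j, (\sum_i f i j == r)%N]]|.
Proof.
pose h (f : {ffun 'I_n -> {ffun 'I_n -> 'I_r.+1}}) := \matrix_(i, j) f i j.
have hI : injective h.
  move=> f g fg; apply/ffunP => i; apply/ffunP => j.
  by have := congr1 (fun A : 'M_n => A i j) fg; rewrite !mxE.
rewrite -(card_imset _ hI); apply: eq_card => A; rewrite inE.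
apply/andP/imsetP => [[rowA colA]|[f]].
  exists [ffun i => [ffun j => A i j]].
    rewrite inE; apply/andP; split; apply/forallP => i;
      [have /eqP e := forallP rowA i|have /eqP e := forallP colA i];
      by apply/eqP; rewrite -[RHS]e; apply: eq_bigr => j _; rewrite !ffunE.
  by apply/matrixP => i j; rewrite !mxE !ffunE.
rewrite inE => /andP[rowf colf] ->; split; apply/forallP => i;
  [have /eqP e := forallP rowf i|have /eqP e := forallP colf i];
  by apply/eqP; rewrite -[RHS]e; apply: eq_bigr => j _; rewrite mxE.
Qed.

Lemma natr_H (F : finFieldType) (n r : nat) (z : F) :
    r.+1.-primitive_root z ->
  (H n r)%:R * r.+1%:R ^+ n =
    \sum_(x : {ffun 'I_n -> F} | x \in ffun_on (Omega F r.+1))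
      (\prod_i x i) * hsym r x ^+ n :> F.
Proof.
move=> pz; pose P (a : {ffun 'I_n -> 'I_r.+1}) := (\sum_i a i == r)%N.
(* Row [f i] is the exponent vector chosen in the [i]-th factor [hsym r x], so [x j] gets the [j]-th
   column sum as exponent, plus 1 from the product of the entries. *)
have -> : \sum_(x : {ffun 'I_n -> F} | x \in ffun_on (Omega F r.+1))
      (\prod_i x i) * hsym r x ^+ n =
    \sum_(f : {ffun 'I_n -> {ffun 'I_n -> 'I_r.+1}} | f \in ffun_on P)
      \prod_j \sum_(a in Omega F r.+1) a ^+ (\sum_i f i j).+1.
  under eq_bigr => x _.
    rewrite -[n in hsym r x ^+ n]card_ord -prodr_const /hsym bigA_distr_big.
    rewrite big_distrr; over.
  rewrite exchange_big; apply: eq_bigr => f _ /=.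
  rewrite bigA_distr_big; apply: eq_bigr => x _ /=.
  rewrite exchange_big -big_split; apply: eq_bigr => j _ /=.
  by rewrite exprS expr_sum.
under eq_bigr do under eq_bigr do rewrite (sum_Omega_expr _ pz).
rewrite H_ffun -sum1_card natr_sum big_distrl /=.
rewrite [LHS]big_mkcond [RHS]big_mkcond /=.
apply: eq_bigr => f _; rewrite inE mul1r.
have -> : f \in ffun_on P = [forall i, (\sum_j f i j == r)%N].
  by apply/ffun_onP/forallP.
case: ifPn => [/andP[-> /forallP colf]|nf].
  rewrite (eq_bigr (fun=> r.+1%:R)) ?prodr_const ?card_ord // => j _.
  by rewrite (eqP (colf j)) dvdnn.
case: ifP => // rowf; rewrite rowf in nf.
(* Otherwise every column sum is at least [r]; the rows fix the total at [n * r], so every column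
   sum would equal [r]. *)
have [j ndj] : exists j, ~~ (r.+1 %| (\sum_i f i j).+1)%N.
  apply/existsP; rewrite -negb_forall; apply: contra nf => /forallP dvd.
  have le j : (r <= \sum_i f i j)%N by rewrite -ltnS; apply: dvdn_leq (dvd j).
  have tot : (\sum_(j < n) \sum_i f i j = \sum_(j < n) r)%N.
    rewrite exchange_big; apply: eq_bigr => i _.
    by apply/eqP; exact: (forallP rowf i).
  have [_] := leqif_sum (fun j (_ : xpredT j) => leqif_eq (le j)).
  rewrite tot eqxx => /esym/forallP e; apply/forallP => j.
  by rewrite eq_sym; exact: e.
by rewrite (bigD1 j) //= (negPf ndj) mul0r.
Qed.

(** * Tuple weights, rescaling and repeated values *)

Definition weight (F : finFieldType) (r n : nat) (t : n.-tuple F) : F :=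
  (\prod_i tnth t i) * hsym r (tnth t) ^+ n.

(** The product of the entries contributes [a ^+ n] and the power of [hsym] contributes
    [a ^+ (r * n)], together a power of [a ^+ r.+1]. *)
Lemma weight_scale (F : finFieldType) (r n : nat) (a : F) (t : n.-tuple F) :
  a ^+ r.+1 = 1 -> weight r (map_tuple ( *%R a) t) = weight r t.
Proof.
move=> a1; rewrite /weight.
have -> : hsym r (tnth (map_tuple ( *%R a) t)) = a ^+ r * hsym r (tnth t).
  rewrite -hsym_scale /hsym; apply: eq_bigr => f _; apply: eq_bigr => i _.
  by rewrite tnth_map.
under eq_bigr do rewrite tnth_map.
rewrite big_split /= prodr_const card_ord exprMn mulrACA -exprMn -exprS a1.
by rewrite expr1n mul1r.
Qed.

Lemma Theta_seq_mset (F : finFieldType) (r n : nat) (t : n.-tuple F) :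
  Theta r (seq_mset t) = weight r t.
Proof.
rewrite /Theta /weight hM_seq_mset (perm_size (perm_eq_seq_mset t)) size_tuple.
congr (_ * _); rewrite -(big_tuple _ _ _ xpredT id) /=.
(* Spreading each entry over all of [F] lets the exchange of products collect the multiplicities. *)
rewrite [RHS](eq_bigr (fun b => \prod_(a : F) a ^+ (b == a))); last first.
  move=> b _; rewrite (bigD1 b) //= eqxx expr1 big1 ?mulr1 // => a ab.
  by rewrite eq_sym (negPf ab) expr0.
rewrite exchange_big /=; apply: eq_bigr => a _.
rewrite mset_seqE -expr_sum; congr (_ ^+ _).
by rewrite -sum1_count big_mkcond.
Qed.

Definition repeats (F : finFieldType) (s : seq F) : {set F} :=
  [set a | 2 <= count_mem a s]%N.

Lemma card_repeats_le (F : finFieldType) (s : seq F) :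
  (#|repeats s| <= size s)%N.
Proof.
apply: leq_trans (card_size s); apply/subset_leq_card/subsetP => a.
by rewrite inE => /ltnW; rewrite -has_count has_pred1.
Qed.

Lemma repeats_eq0 (F : finFieldType) (s : seq F) : #|repeats s| = 0%N -> uniq s.
Proof.
move=> /eqP; rewrite cards_eq0 => /eqP s0; apply: count_mem_uniq => a.
have : a \notin repeats s by rewrite s0 inE.
rewrite inE -ltnNge ltnS; have := has_pred1 a s; rewrite has_count.
by case: (a \in s) (count_mem a s) => [] [|[|c]].
Qed.

Lemma weight_repeats (F : finFieldType) (r n : nat) (t : n.-tuple F) :
    (2 <= n)%N -> (forall k, (0 < k <= n)%N -> k%:R != 0 :> F) ->
    all (mem (Omega F r.+1)) t ->
  weight r t = \sum_(a in Omega F r.+1 | (2 <= count_mem a t)%N)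
     weight r t / #|repeats t|%:R.
Proof.
move=> n2 nF /allP Ot.
have Ot1 : {in t, forall a, a ^+ r.+1 = 1}.
  by move=> a /Ot; rewrite /= inE => /eqP.
have -> : \sum_(a in Omega F r.+1 | (2 <= count_mem a t)%N)
    weight r t / #|repeats t|%:R = weight r t / #|repeats t|%:R *+ #|repeats t|.
  rewrite -[RHS]sumr_const; apply: eq_bigl => a; rewrite !inE.
  case: (leqP 2) => [c2|]; rewrite ?andbF ?andbT //.
  by apply/eqP/Ot1; rewrite -has_pred1 has_count ltnW.
(* Without repeated values the right side is an empty sum and the weight vanishes by [hsym_uniq];
   otherwise the divisor lies between 1 and [n], so it is invertible. *)
have [t0|tn0] := posnP #|repeats t|.
  rewrite t0 mulr0n /weight (hsym_uniq n2 (repeats_eq0 t0) Ot1) expr0n.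
  by rewrite eqn0Ngt (ltnW n2) mulr0.
rewrite -mulr_natr divfK // nF // tn0.
by rewrite -[leqRHS](size_tuple t) card_repeats_le.
Qed.

Lemma sum_weight (F : finFieldType) (r n : nat) (z : F) :
    (2 <= n)%N -> (forall k, (0 < k <= n)%N -> k%:R != 0 :> F) ->
    r.+1.-primitive_root z ->
  \sum_(t : n.-tuple F | all (mem (Omega F r.+1)) t) weight r t =
  r.+1%:R * \sum_(t : n.-tuple F | all (mem (Omega F r.+1)) t &&
     (2 <= count_mem 1%R t)%N) weight r t / #|repeats t|%:R.
Proof.
move=> n2 nF pz.
under eq_bigr => t Ot do rewrite (weight_repeats n2 nF Ot).
rewrite (exchange_big_dep (mem (Omega F r.+1))) /=; last by move=> t a _ /andP[].
(* The factor [r.+1] becomes a sum of ones over [Omega], so that the two sides can be compared for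
   each [a] separately. *)
rewrite -[r.+1%:R](_ : \sum_(a in Omega F r.+1) a ^+ 0 = _); last first.
  by rewrite (sum_Omega_expr _ pz) dvdn0.
rewrite big_distrl /=; apply: eq_bigr => a Oa; rewrite expr0 mul1r.
have a1 : a ^+ r.+1 = 1 by move: Oa; rewrite inE => /eqP.
have a0 : a != 0.
  apply/eqP => a0; move: a1; rewrite a0 expr0n /= => /esym/eqP.
  by rewrite oner_eq0.
have inj := mulfI a0.
have count_scale c (t : n.-tuple F) :
    count_mem (a * c) (map_tuple ( *%R a) t) = count_mem c t.
  by rewrite count_map; apply: eq_count => b; rewrite /= (inj_eq inj).
(* Scaling by [a] is a bijection on tuples, taking a repeated 1 to a repeated [a]; no orbit is ever
   counted. *)
rewrite (reindex_inj (h := map_tuple ( *%R a))); last first.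
  by move=> s t /(congr1 val) /(inj_map inj)/val_inj.
apply: eq_big => [t|t _].
  rewrite /= Oa /= -[a in (_ <= count_mem a _)%N](mulr1 a) count_scale all_map.
  congr (_ && _).
  by apply: eq_all => b; rewrite /= !inE exprMn a1 mul1r.
rewrite weight_scale //; congr (_ / _%:R).
rewrite -[RHS](card_imset _ inj); apply: eq_card => b.
apply/idP/imsetP => [br|[c cr ->]].
  exists (a^-1 * b); last by rewrite mulVKf.
  by move: br; rewrite !inE -{1}[b](mulVKf a0) count_scale.
by move: cr; rewrite !inE count_scale.
Qed.

(** * From multisets to tuples *)

(** [mult M] counts the tuples that list [M], so each multiset is replaced by its orderings;
    conversely a tuple [t] lists only [seq_mset t]. *)
Lemma sum_multisets1 (F : finFieldType) (r n : nat) :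
  \sum_(M <- multisets1 F n r.+1) (mult M)%:R / (tM M)%:R * Theta r M =
  \sum_(t : n.-tuple F | all (mem (Omega F r.+1)) t &&
     (2 <= count_mem 1%R t)%N) weight r t / #|repeats t|%:R.
Proof.
rewrite /multisets1 big_fset /=.
transitivity (\sum_(M <- multisets n (Omega F r.+1) | (2 <= M 1%R)%N)
   \sum_(t : n.-tuple F | perm_eq t (M : {mset F})) Theta r M / (tM M)%:R).
  rewrite big_seq_cond [RHS]big_seq_cond; apply: eq_bigr => M.
  rewrite in_multisets => /andP[/andP[/eqP sM _] _].
  rewrite -[LHS]mulrA [X in _ * X]mulrC [RHS]sumr_const -[RHS]mulr_natl.
  congr (_%:R * _).
  rewrite /mult (eq_bigr (fun a => (count_mem a (M : {mset F}))`!)); last first.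
    by move=> a _; rewrite count_mem_mset.
  by rewrite sM -(card_perm_eq_tuple sM); apply: eq_card => t; rewrite !inE.
rewrite (exchange_big_dep xpredT) //= [RHS]big_mkcond /=; apply: eq_bigr => t _.
have tE (M : {mset F}) : perm_eq t M = (M == seq_mset t).
  apply/idP/eqP => [/eq_seq_msetP ->|->]; first by rewrite seq_mset_id.
  by rewrite perm_sym perm_eq_seq_mset.
under eq_bigl do rewrite tE.
have tX : (seq_mset t \in multisets n (Omega F r.+1)) =
    all (mem (Omega F r.+1)) t.
  have e := perm_eq_seq_mset t.
  by rewrite in_multisets (perm_size e) (perm_all _ e) size_tuple eqxx.
case: ifP => [/andP[Ot c2]|/negbT nt].
  rewrite (eq_bigl (fun M => M == seq_mset t)) => [|M]; last first.
    by rewrite andbC; case: eqP => // ->; rewrite mset_seqE.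
  rewrite -big_filter filter_pred1_uniq ?fset_uniq ?tX // big_seq1.
  rewrite Theta_seq_mset; congr (_ / _%:R).
  by apply: eq_card => a; rewrite !inE mset_seqE.
rewrite big_seq_cond big1 // => M /andP[MX /andP[M2 /eqP Mt]].
by rewrite -tX -mset_seqE -Mt MX M2 in nt.
Qed.

Lemma sum_tuple_ffun (F : finFieldType) (r n : nat) (A : {set F}) :
  \sum_(x : {ffun 'I_n -> F} | x \in ffun_on A) (\prod_i x i) * hsym r x ^+ n =
  \sum_(t : n.-tuple F | all (mem A) t) weight r t.
Proof.
rewrite (reindex (fun t : n.-tuple F => [ffun i => tnth t i])) /=; last first.
  exists (fun x : {ffun 'I_n -> F} => [tuple x i | i < n]) => [t|x] _.
    by apply: eq_from_tnth => i; rewrite tnth_mktuple ffunE.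
  by apply/ffunP => i; rewrite ffunE tnth_mktuple.
apply: eq_big => [t|t _].
  by apply/ffun_onP/all_tnthP => tA i; have := tA i; rewrite ffunE.
rewrite /weight /hsym; under eq_bigr do rewrite ffunE.
congr (_ * _ ^+ _); apply: eq_bigr => f _; apply: eq_bigr => i _.
by rewrite ffunE.
Qed.

(** * Specialization to the prime field *)

(** The [p - 1] nonzero elements are all roots of unity of order dividing [p - 1], so one is
    primitive; its power by the cofactor of [m] has order [m]. *)
Lemma Fp_prim_root (p m : nat) :
  prime p -> (m %| p - 1)%N -> exists z : 'F_p, m.-primitive_root z.
Proof.
move=> pp mp; have p1 : (0 < p - 1)%N by rewrite subn_gt0 prime_gt1.
have : has (p - 1).-primitive_root (enum [set~ (0 : 'F_p)]).
  apply: has_prim_root; rewrite ?enum_uniq //.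
    apply/allP => x; rewrite mem_enum !inE => x0; rewrite unity_rootE.
    apply/eqP/(mulfI x0); rewrite mulr1 -exprS -addn1 subnK ?prime_gt0 //.
    by have := expf_card x; rewrite card_Fp.
  by rewrite -cardE cardsC1 card_Fp // subn1.
case/hasP => z _ pz; exists (z ^+ ((p - 1) %/ m)).
exact: dvdn_prim_root.
Qed.

Theorem theorem2p5 (n r p : nat) :
  (3 <= n)%N -> prime p -> (n < p)%N -> (r.+1 %| p - 1)%N ->
  ((H n r)%:R : 'F_p) =
    r.+1%:R ^ (1 - n%:Z) *
    \sum_(M <- multisets1 'F_p n r.+1) (mult M)%:R / (tM M)%:R * Theta r M.
Proof.
move=> n3 pp np mp; have [z pz] := Fp_prim_root pp mp.
have natF k : (0 < k < p)%N -> (k%:R : 'F_p) != 0.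
  by move=> /andP[k0 kp]; rewrite -(dvdn_pcharf (pchar_Fp pp)) gtnNdvd.
have m0 : (r.+1%:R : 'F_p) != 0.
  apply: natF => /=; rewrite -ltnS -[p]prednK ?prime_gt0 // ltnS ltnS -subn1.
  by apply: dvdn_leq mp; rewrite subn_gt0 prime_gt1.
have nF k : (0 < k <= n)%N -> (k%:R : 'F_p) != 0.
  by move=> /andP[k0 kn]; apply: natF; rewrite k0 (leq_ltn_trans kn).
(* Multiplying by the [n]-th power of [r.+1] matches [natr_H] and leaves on the right the single
   factor [r.+1] of [sum_weight]. *)
apply: (mulIf (expf_neq0 n m0)).
rewrite (natr_H _ pz) sum_tuple_ffun (sum_weight (ltnW n3) nF pz) sum_multisets1.
rewrite mulrAC; congr (_ * _).
by rewrite -[_ ^+ n]/(_ ^ n%:Z) -expfzDr // subrK expr1z.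
Qed.
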